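(* Let $\alpha\in(0,1]$, let $X$ and $Y$ be two real-valued random variables, and let $\lambda=\mathrm{VaR}_\alpha(X)$. Then $$\mathbb P(Y\le\lambda)<\alpha \iff \mathrm{VaR}_\alpha(Y)>\mathrm{VaR}_\alpha(X),$$ $$\mathbb P(Y\le\lambda)\ge\alpha \iff \mathrm{VaR}_\alpha(Y)\le\mathrm{VaR}_\alpha(X).$$
   Context: For a real-valued random variable $X$ and $\alpha\in(0,1]$, the value-at-risk (the $\alpha$-quantile) is $\mathrm{VaR}_\alpha(X):=\inf\{\lambda\in\mathbb R:\mathbb P(X\le\lambda)\ge\alpha\}$, with the usual convention $\inf\emptyset=+\infty$ (possible only when $\alpha=1$; in that case $\mathbb P(Y\le+\infty)=1$). *)

(* Defs.v *)
From HB Require Import structures.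
From mathcomp Require Import all_boot all_order all_algebra.
From mathcomp Require Import all_classical all_reals all_analysis.

Set Implicit Arguments.
Unset Strict Implicit.
Unset Printing Implicit Defensive.

Import Order.TTheory GRing.Theory Num.Theory.
Import numFieldNormedType.Exports.

Local Open Scope classical_set_scope.
Local Open Scope ereal_scope.

(** The infimum is taken in [\bar R], so that it equals [+oo] when no real [l]
    satisfies [alpha%:E <= P (X <= l)] ([ereal_inf set0 = +oo]). *)
Definition VaR (d : measure_display) (T : measurableType d) (R : realType)
    (P : probability T R) (alpha : R) (X : {RV P >-> R}) : \bar R :=
  ereal_inf [set l%:E | l in [set l : R | alpha%:E <= P [set t | (X t <= l)%R]]].

(* Main.v *)
(** The lower quantile is a left adjoint of the distribution function:
    [alpha <= P (Y <= lambda) <-> VaR alpha Y <= lambda] for every extended real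
    [lambda], by right continuity of the distribution function and its limit [0]
    at [-oo]. Take [lambda := VaR alpha X]. *)

Require Import Defs.
From HB Require Import structures.
From mathcomp Require Import all_boot all_order all_algebra.
From mathcomp Require Import all_classical all_reals all_analysis.

Set Implicit Arguments.
Unset Strict Implicit.
Unset Printing Implicit Defensive.

Import Order.TTheory GRing.Theory Num.Theory.
Import numFieldNormedType.Exports.

Local Open Scope classical_set_scope.
Local Open Scope ereal_scope.

(** A number strictly above an infimum dominates some member [l] of the set, and the distribution
    function is nondecreasing. *)
Lemma VaR_lt_cdf (d : measure_display) (T : measurableType d) (R : realType)
    (P : probability T R) (alpha : R) (Y : {RV P >-> R}) (r : R) :
  VaR alpha Y < r%:E -> alpha%:E <= cdf Y r.
Proof.
case/ereal_inf_lt => _ [l /= alpha_l <-]; rewrite lte_fin => /ltW l_r.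
exact: le_trans alpha_l (cdf_nondecreasing Y l_r).
Qed.

Lemma VaR_leP (d : measure_display) (T : measurableType d) (R : realType)
    (P : probability T R) (alpha : R)
    (alpha_gt0 : (0 < alpha)%R) (alpha_le1 : (alpha <= 1)%R)
    (Y : {RV P >-> R}) (lambda : \bar R) :
  alpha%:E <= P [set t | (Y t)%:E <= lambda] <-> VaR alpha Y <= lambda.
Proof.
case: lambda => [a| |].
- split=> [alpha_a|VaR_a].
    apply: ereal_inf_lbound; exists a => //=.
  suff : alpha%:E <= cdf Y a by [].
  (* The bound holds at every [r > a]; right continuity carries it to [a] itself. *)
  apply: (cvge_to_ge (@cdf_right_continuous _ _ _ _ Y a)).
  near=> r; apply: VaR_lt_cdf.
  by rewrite (le_lt_trans VaR_a)// lte_fin.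
- rewrite leey; split=> // _.
  (* The event is the whole space, so the claim is [alpha <= 1]. *)
  rewrite (_ : [set t | _] = setT) ?probability_setT ?lee_fin//.
  by apply/seteqP; split=> // t _ /=; exact: leey.
- rewrite (_ : [set t | _] = set0) ?measure0; last first.
    by apply/seteqP; split=> // t /=; rewrite leeNy_eq.
  rewrite lee_fin leNgt alpha_gt0; split=> // VaR_Ny.
  (* A quantile equal to [-oo] would give [alpha <= cdf Y r] for every real [r], hence [alpha <= 0]
     in the limit at [-oo]. *)
  suff : alpha%:E <= 0 by rewrite lee_fin leNgt alpha_gt0.
  apply: (cvge_to_ge (cvg_cdfNy0 Y)).
  by apply: nearW => r; apply: VaR_lt_cdf; rewrite (le_lt_trans VaR_Ny) ?ltNyr.
Unshelve. all: by end_near. Qed.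

Theorem lemma1 (d : measure_display) (T : measurableType d) (R : realType)
    (P : probability T R) (alpha : R)
    (alpha_gt0 : (0 < alpha)%R) (alpha_le1 : (alpha <= 1)%R)
    (X Y : {RV P >-> R}) (lambda : \bar R) (lambdaE : lambda = VaR alpha X) :
  (P [set t | (Y t)%:E <= lambda] < alpha%:E <-> VaR alpha Y > VaR alpha X) /\
  (P [set t | (Y t)%:E <= lambda] >= alpha%:E <-> VaR alpha Y <= VaR alpha X).
Proof.
have galois := VaR_leP alpha_gt0 alpha_le1 Y lambda.
rewrite -lambdaE; split; last exact: galois.
(* The order on [\bar R] is total, so the strict equivalence is the negation of [galois]. *)
by rewrite !ltNge; split=> /negP h; apply/negP => /galois.
Qed.
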